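(* Let $C$ be a finite power associative loop, $m\ge 1$ an integer, and $\mathbf r=(r_0,\dots,r_{m-1})$ an $m$-tuple of positive integers. Then the probability $p_{\mathbf r}(C)=|C|^{-m}\cdot|\mathrm{Gen}_{\mathbf r}(C)|$ that $m$ randomly chosen elements $a_0,\dots,a_{m-1}$ of $C$ generate $C$ and $(a_0,\dots,a_{m-1})$ is of type $\mathbf r$ satisfies $$p_{\mathbf r}(C)=|C|^{-m}\sum_{[\mathbf a]\in \mathrm{Gen}_{\mathbf r}(C)/\sim_{\mathbf r}}\ \ \sum_{\mathbf s=(s_0,\dots,s_{m-1})}\ \prod_{i=0}^{m-1}\Gamma_{s_i}(A_i,A_{i+1}),$$ where the outer sum runs over the $\sim_{\mathbf r}$-equivalence classes in $\mathrm{Gen}_{\mathbf r}(C)$, $\{A_i\}_{i=0}^m$ is the sequence of nested subloops associated with a chosen representative $\mathbf a$ of the class, and the inner sum runs over all (distinct) $m$-tuples $\mathbf s$ of the same type as $\mathbf r$.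
   Context: A loop $C$ is power associative if every element of $C$ generates a group. For subloops and elements, $\langle\,\cdot\,\rangle$ denotes the subloop of $C$ generated by the given data. For a positive integer $i$, $D_i$ is the set of all elements of $C$ of order $i$. Two $m$-tuples of integers $\mathbf r=(r_0,\dots,r_{m-1})$ and $\mathbf s=(s_0,\dots,s_{m-1})$ are of the same type if $r_0,\dots,r_{m-1}$ is a permutation of $s_0,\dots,s_{m-1}$. A tuple $\mathbf a=(a_0,\dots,a_{m-1})\in C^m$ is of type $\mathbf r$ if there is $\mathbf s$ of the same type as $\mathbf r$ with $a_i\in D_{s_i}$ for $0\le i\le m-1$. Given $\mathbf a=(a_0,\dots,a_{m-1})\in C^m$, the associated sequence of nested subloops $\{A_i\}_{i=0}^m$ is defined by letting $A_0=\{e\}$ be the smallest subloop of $C$ and $A_{i+1}=\langle A_i,a_i\rangle$ for $0\le i\le m-1$. $\mathrm{Gen}_m(C)$ is the set of all $\mathbf a\in C^m$ with $A_m=C$, and $\mathrm{Gen}_{\mathbf r}(C)\subseteq\mathrm{Gen}_m(C)$ is the set of those $\mathbf a\in\mathrm{Gen}_m(C)$ that are of type $\mathbf r$. $\mathrm{Aut}(C)$ acts naturally on the lattice of subloops of $C$; $O_B$ denotes the orbit of a subloop $B\le C$. For $A,B\le C$ and a positive integer $i$, $\Gamma_i(A,B)$ is the number of elements $x\in D_i$ such that $\langle A,x\rangle\in O_B$. Two tuples $\mathbf a,\mathbf b\in C^m$ with associated sequences $\{A_i\}$, $\{B_i\}$ are orbit-equivalent, $\mathbf a\sim\mathbf b$,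 if $A_i\in O_{B_i}$ for all $0\le i\le m$; $\sim_{\mathbf r}$ is the restriction of $\sim$ to $\mathrm{Gen}_{\mathbf r}(C)$. *)

(* Defs.v *)
From HB Require Import structures.
From mathcomp Require Import all_boot all_order all_fingroup all_algebra.

Set Implicit Arguments.
Unset Strict Implicit.
Unset Printing Implicit Defensive.

(* The operations are declared from scratch because a non-associative finite
   structure cannot be built on [umagmaType]: the hierarchy lacks the join of
   [baseUMagmaType] and [countType] below [finStarMonoidType].
   [ldiv x y] is the unique z with x ** z = y, and [rdiv y x] the unique z
   with z ** x = y: existence is [lmul_ldiv] and [lmul_rdiv], uniqueness is
   [ldiv_lmul] and [rdiv_lmul]. *)
HB.mixin Record isLoop C := {
  lone : C;
  lmul : C -> C -> C;
  ldiv : C -> C -> C;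
  rdiv : C -> C -> C;
  lmul1x : left_id lone lmul;
  lmulx1 : right_id lone lmul;
  lmul_ldiv : forall x y, lmul x (ldiv x y) = y;
  ldiv_lmul : forall x y, ldiv x (lmul x y) = y;
  lmul_rdiv : forall x y, lmul (rdiv y x) x = y;
  rdiv_lmul : forall x y, rdiv (lmul y x) x = y
}.

#[short(type="finLoopType")]
HB.structure Definition FinLoop := {C of isLoop C & Finite C}.

Declare Scope loop_scope.
Local Open Scope loop_scope.

Notation "x ** y" := (lmul x y)
  (at level 40, left associativity) : loop_scope.

Section FiniteLoops.

Variable C : finLoopType.
Implicit Types (x y z : C) (A B : {set C}).

Definition subloop A : bool :=
  (lone \in A) &&
  [forall x in A, forall y in A,
     [&& x ** y \in A, ldiv x y \in A & rdiv x y \in A]].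

Definition loop_gen A : {set C} :=
  \bigcap_(B : {set C} | subloop B && (A \subset B)) B.

Definition is_group A : Prop :=
  [/\ lone \in A,
      {in A &, forall x y, x ** y \in A},
      {in A & &, forall x y z, x ** (y ** z) = (x ** y) ** z} &
      {in A, forall x, exists2 y, y \in A & y ** x = lone /\ x ** y = lone}].

Definition power_associative : Prop :=
  forall x, is_group (loop_gen [set x]).

(* As for [order] of group elements, the order of x is the cardinal of the
   group generated by x. *)
Definition loop_order x : nat := #|loop_gen [set x]|.

Definition elts_of_order (i : nat) : {set C} := [set x | loop_order x == i].

(* The sequence A_0, A_1, ... of nested subloops of a = (a_0, a_1, ...); it is
   only meaningful up to index [size a]. *)
Fixpoint nested (a : seq C) (i : nat) : {set C} :=
  if i is j.+1 then loop_gen (nested a j :|: [set nth lone a j]) else [set lone].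

Definition loop_aut : {set {perm C}} :=
  [set f : {perm C} | [forall x, forall y, f (x ** y) == f x ** f y]].

Definition subloop_orbit B : {set {set C}} := orbit ('P^*)%act loop_aut B.

Definition Gamma (i : nat) A B : nat :=
  #|[set x in elts_of_order i | loop_gen (A :|: [set x]) \in subloop_orbit B]|.

Section Tuples.

Variable m : nat.
Implicit Types (r : m.-tuple nat) (a b : m.-tuple C).

Definition Gen : {set m.-tuple C} := [set a : m.-tuple C | nested a m == [set: C]].

(* [permutations r] is the duplicate-free list of all rearrangements of r,
   i.e. of all the tuples of the same type as r. *)
Definition of_type r a : bool :=
  has (fun s => [forall i : 'I_m, tnth a i \in elts_of_order (nth 0%N s i)])
      (permutations r).

Definition Gen_type r : {set m.-tuple C} := [set a in Gen | of_type r a].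

Definition orbit_equiv a b : bool :=
  [forall i : 'I_m.+1, nested a i \in subloop_orbit (nested b i)].

Definition Gen_classes r : {set {set m.-tuple C}} :=
  equivalence_partition orbit_equiv (Gen_type r).

Definition gen_prob r : rat :=
  ((#|C|%:R ^- m) * #|Gen_type r|%:R)%R.

End Tuples.

End FiniteLoops.

(* Main.v *)
(** Two tuples of a class K have subloops in the same orbits, so the tuples in K
    with prescribed orders s_0, ..., s_{m-1} can be counted one entry at a time:
    if b_0, ..., b_{i-1} are already chosen, with B_i in the orbit of A_i, then
    the number of admissible b_i is Gamma_{s_i}(B_i, A_{i+1}), which equals
    Gamma_{s_i}(A_i, A_{i+1}) because automorphisms preserve orders and orbits. *)
Require Import Defs.
From HB Require Import structures.
From mathcomp Require Import all_boot all_order all_fingroup all_algebra.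

Set Implicit Arguments.
Unset Strict Implicit.
Unset Printing Implicit Defensive.

(** * Automorphisms, generated subloops and the invariance of [Gamma] *)

Section Automorphisms.

Local Open Scope loop_scope.

Variable C : finLoopType.
Implicit Types (x y z : C) (A B : {set C}) (f g : {perm C}).

Lemma loop_autP f : reflect {morph f : x y / x ** y} (f \in loop_aut C).
Proof.
rewrite inE; apply: (iffP forallP) => [fM x y | fM x].
  by have /forallP/(_ y)/eqP := fM x.
by apply/forallP => y; rewrite fM.
Qed.

(** [loop_aut] is declared as a bare set; the group structure supplies inverses and makes lying in
    the same orbit an equivalence. *)
Lemma loop_aut_group_set : group_set (loop_aut C).
Proof.
apply/group_setP; split=> [|f g /loop_autP fM /loop_autP gM].
  by apply/loop_autP => x y; rewrite !perm1.
by apply/loop_autP => x y; rewrite !permM fM gM.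
Qed.

Canonical loop_aut_group := Group loop_aut_group_set.

Lemma loop_aut_ldiv f : f \in loop_aut C -> {morph f : x y / ldiv x y}.
Proof.
by move/loop_autP => fM x y; rewrite -[in RHS](lmul_ldiv x y) fM ldiv_lmul.
Qed.

Lemma loop_aut_rdiv f : f \in loop_aut C -> {morph f : x y / rdiv x y}.
Proof.
by move/loop_autP => fM x y; rewrite -[in RHS](lmul_rdiv y x) fM rdiv_lmul.
Qed.

(** [f lone] is idempotent, and left cancellation leaves [lone] as the only idempotent of a loop. *)
Lemma loop_aut1 f : f \in loop_aut C -> f lone = lone.
Proof.
move=> /loop_autP fM; rewrite -[LHS](ldiv_lmul (f lone)) -fM lmul1x.
by rewrite -[X in ldiv _ X]lmulx1 ldiv_lmul.
Qed.

Lemma loop_aut_subloop f A : f \in loop_aut C -> subloop A -> subloop (f @: A).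
Proof.
move=> fA /andP[A1 /forall_inP AP]; apply/andP; split.
  by rewrite -(loop_aut1 fA) imset_f.
apply/forall_inP => _ /imsetP[x Ax ->]; apply/forall_inP => _ /imsetP[y Ay ->].
have /forall_inP/(_ y Ay)/and3P[xy_A xVy_A x_y_A] := AP x Ax.
rewrite -(loop_autP _ fA) -loop_aut_ldiv // -loop_aut_rdiv //.
by rewrite !imset_f.
Qed.

Lemma loop_gen_subP A x :
  reflect (forall B, subloop B -> A \subset B -> x \in B) (x \in loop_gen A).
Proof.
apply: (iffP bigcapP) => [gAx B loopB sAB | gAx B /andP[]]; last exact: gAx.
by apply: gAx; rewrite loopB.
Qed.

Lemma loop_aut_gen f A :
  f \in loop_aut C -> f @: loop_gen A = loop_gen (f @: A).
Proof.
(* One inclusion for all automorphisms suffices: taken for the inverse of [f] and pushed forward by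
   [f], it gives the reverse one. *)
have sub g D : g \in loop_aut C -> g @: loop_gen D \subset loop_gen (g @: D).
  move=> gA; apply/subsetP => _ /imsetP[x /loop_gen_subP gDx ->].
  apply/loop_gen_subP => B loopB sDB.
  (* Pulling [B] back along [g] yields a subloop that contains [D], hence [x]. *)
  have /imsetP[y By ->] : x \in g^-1%g @: B; last by rewrite permKV.
  apply: gDx; first by rewrite loop_aut_subloop // groupV.
  by apply/subsetP => y Dy; rewrite -(permK g y) imset_f // (subsetP sDB) ?imset_f.
move=> fA; apply/eqP; rewrite eqEsubset sub //=.
have fV : f^-1%g \in loop_aut C by rewrite groupV.
have /(imsetS f) := sub _ (f @: A) fV.
rewrite -!imset_comp !(eq_imset _ (permK f), eq_imset _ (permKV f)).
by rewrite !imset_id.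
Qed.

Lemma loop_aut_order f x : f \in loop_aut C -> loop_order (f x) = loop_order x.
Proof.
move=> fA; rewrite /loop_order -imset_set1 -loop_aut_gen // card_imset //; apply: perm_inj.
Qed.

Lemma subloop_orbitP A B :
  reflect (exists2 f, f \in loop_aut C & f @: B = A) (A \in subloop_orbit B).
Proof.
by apply: (iffP orbitP) => -[f fA <-]; exists f; rewrite //= setactE.
Qed.

Lemma subloop_orbit_refl A : A \in subloop_orbit A.
Proof. exact: orbit_refl. Qed.

Lemma subloop_orbit_eq A B :
  A \in subloop_orbit B -> subloop_orbit A = subloop_orbit B.
Proof. by move/orbit_eqP. Qed.

Lemma subloop_orbit_sym A B :
  (A \in subloop_orbit B) = (B \in subloop_orbit A).
Proof. exact: orbit_sym. Qed.

Lemma subloop_orbit_aut f A B :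
  f \in loop_aut C -> (f @: A \in subloop_orbit B) = (A \in subloop_orbit B).
Proof.
move=> fA; have fAA : f @: A \in subloop_orbit A.
  by apply/subloop_orbitP; exists f.
by rewrite -!(subloop_orbit_sym B) (subloop_orbit_eq fAA).
Qed.

Lemma subloop_orbitT A : (A \in subloop_orbit setT) = (A == setT).
Proof.
rewrite subloop_orbit_sym; apply/subloop_orbitP/eqP=> [[f _ fAT] | ->].
  by apply/eqP; rewrite eqEcard subsetT -fAT (card_imset _ perm_inj) /=.
by exists 1%g; rewrite ?group1 // (eq_imset _ (@perm1 _)) imset_id.
Qed.

(** An automorphism carrying [A] to [A'] maps the elements counted for [A] bijectively onto those
    counted for [A']. *)
Lemma Gamma_orbit i A A' B :
  A' \in subloop_orbit A -> Gamma i A' B = Gamma i A B.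
Proof.
case/subloop_orbitP=> f fA <-; rewrite /Gamma -[RHS](card_imset _ (@perm_inj _ f)).
apply: eq_card => y; rewrite -[y](permKV f) mem_imset; last exact: perm_inj.
rewrite !inE loop_aut_order //; congr (_ && _).
by rewrite -imset_set1 -imsetU -loop_aut_gen // subloop_orbit_aut.
Qed.

End Automorphisms.

(** * Counting tuples with prescribed orders and subloop orbits *)

Section Counting.

Variable C : finLoopType.
Implicit Types (a b s : seq C) (x : C).

(** The subloop of index [i] depends only on the entries of index below [i], so [i = size b] is
    still allowed. *)
Lemma nested_rcons b x i : i <= size b -> nested (rcons b x) i = nested b i.
Proof.
elim: i => //= i IHi lt_ib; rewrite IHi ?(ltnW lt_ib) //.
by rewrite nth_rcons lt_ib.
Qed.

Lemma nested_rcons_size b x :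
  nested (rcons b x) (size b).+1 = loop_gen (nested b (size b) :|: [set x]).
Proof. by rewrite /= nested_rcons // nth_rcons ltnn eqxx. Qed.

(** Reindexes a sum over tuples by an initial part and a last entry, the one chosen last in the
    count. *)
Lemma tuple_rcons_bij (T : Type) k :
  bijective (fun p : k.-tuple T * T => [tuple of rcons p.1 p.2]).
Proof.
exists (fun t : k.+1.-tuple T =>
  ([tuple of belast (thead t) (behead t)], last (thead t) (behead t))).
  move=> [b x] /=; congr (_, _); last first.
    by case: b => [[|y b] sb] //=; rewrite last_rcons.
  apply: val_inj => /=; case: b => [[|y b] sb] //=.
  by rewrite /thead (tnth_nth x) /= belast_rcons.
by move=> t; apply: val_inj; rewrite /= -lastI [in RHS](tuple_eta t).
Qed.

(** Functions on [nat] and a plain sequence let the same [o] and [A] serve for every length [k] of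
    the induction. There are [k] orders but [k.+1] subloops. *)
Definition matches (o : nat -> nat) (A : nat -> {set C}) k b :=
  [forall i : 'I_k, loop_order (nth lone b i) == o i]
    && [forall i : 'I_k.+1, nested b i \in subloop_orbit (A i)].

Lemma matches_rcons o A k b x : size b = k ->
  matches o A k.+1 (rcons b x) =
    [&& matches o A k b, x \in elts_of_order C (o k) &
        loop_gen (nested b k :|: [set x]) \in subloop_orbit (A k.+1)].
Proof.
move=> sb; have nth_k : nth lone (rcons b x) k = x.
  by rewrite nth_rcons sb ltnn eqxx.
have nest_k : nested (rcons b x) k.+1 = loop_gen (nested b k :|: [set x]).
  by rewrite -sb nested_rcons_size.
apply/andP/and3P => [[/forallP oP /forallP AP] |
                     [/andP[/forallP oP /forallP AP] ox Ax]].
  split; last by rewrite -nest_k; apply: (AP ord_max).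
    apply/andP; split; apply/forallP=> i.
      by have := oP (widen_ord (leqnSn k) i); rewrite /= nth_rcons sb ltn_ord.
    have := AP (widen_ord (leqnSn k.+1) i).
    by rewrite nested_rcons //= sb -ltnS.
  by have := oP ord_max; rewrite /= nth_k inE.
split; apply/forallP=> i.
  have [lt_ik|le_ki] := ltnP i k.
    by have := oP (Ordinal lt_ik); rewrite /= nth_rcons sb lt_ik.
  have -> : i = k :> nat by apply/eqP; rewrite eqn_leq le_ki -ltnS ltn_ord.
  by rewrite nth_k; rewrite inE in ox.
have [lt_ik|le_ki] := ltnP i k.+1.
  by rewrite nested_rcons ?sb //; apply: (AP (Ordinal lt_ik)).
have -> : i = k.+1 :> nat by apply/eqP; rewrite eqn_leq le_ki -ltnS ltn_ord.
by rewrite nest_k.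
Qed.

Lemma card_matches o (A : nat -> {set C}) k : A 0 = [set lone] ->
  #|[set b : k.-tuple C | matches o A k b]| =
    \prod_(i < k) Gamma (o i) (A i) (A i.+1).
Proof.
move=> A0; elim: k => [|k IHk].
  (* The empty tuple is counted once: its only subloop is trivial, and so is [A 0]. *)
  rewrite big_ord0; apply/eqP/cards1P; exists [tuple]; apply/setP=> b.
  rewrite tuple0 !inE eqxx; apply/andP.
  by split; apply/forallP=> -[] // [|//] ?; rewrite /= A0 subloop_orbit_refl.
rewrite big_ord_recr /= -IHk -sum1dep_card.
rewrite (reindex _ (onW_bij _ (tuple_rcons_bij C k))) /=.
under eq_bigl => p do rewrite matches_rcons ?size_tuple //.
(* Splits the count into an outer sum over the matching [b] and, for each of them, the number of
   admissible last entries [x]. *)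
rewrite -(pair_big_dep (fun b : k.-tuple C => matches o A k b)
  (fun (b : k.-tuple C) x => (x \in elts_of_order C (o k)) &&
     (loop_gen (nested b k :|: [set x]) \in subloop_orbit (A k.+1)))
  (fun _ _ => 1)) /=.
rewrite -sum1dep_card big_distrl /=; apply: eq_bigr => b /andP[_ /forallP AP].
(* The inner count is a [Gamma] at [nested b k]; the last orbit condition on [b] allows replacing
   this subloop by [A k]. *)
by rewrite mul1n sum1dep_card -(Gamma_orbit _ _ (AP ord_max)).
Qed.

Variable m : nat.
Implicit Types (r : m.-tuple nat).

(** An element has only one order, so the sequence of orders of [a] is the only possible witness. *)
Lemma of_typeE r (a : m.-tuple C) :
  of_type r a = perm_eq (map (@loop_order C) a) r.
Proof.
rewrite -mem_permutations; apply/hasP/idP=> [[s s_r /forallP a_s] | a_r].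
  suff <- : s = map (@loop_order C) a by [].
  have sz_s : size s = m.
    by rewrite mem_permutations in s_r; rewrite (perm_size s_r) size_tuple.
  apply: (@eq_from_nth _ 0); rewrite ?size_map ?size_tuple // => i.
  rewrite sz_s => lt_im; have := a_s (Ordinal lt_im).
  by rewrite inE (tnth_nth lone) (nth_map lone) ?size_tuple // eq_sym => /eqP.
exists (map (@loop_order C) a) => //; apply/forallP=> i.
by rewrite inE (tnth_nth lone) (nth_map lone) ?size_tuple.
Qed.

Lemma orbit_equiv_rel : equivalence_rel (@orbit_equiv C m).
Proof.
move=> a b c; split=> [|/forallP ab].
  by apply/forallP=> i; apply: subloop_orbit_refl.
apply: eq_forallb => i.
by rewrite -!(subloop_orbit_sym (nested c i)) (subloop_orbit_eq (ab i)).
Qed.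

Lemma orbit_equiv_sym : symmetric (@orbit_equiv C m).
Proof. by move=> a b; apply: eq_forallb => i; apply: subloop_orbit_sym. Qed.

(** The subloop of index [m] of a generating tuple is the whole loop, which is alone in its
    orbit. *)
Lemma orbit_equiv_Gen (a b : m.-tuple C) :
  orbit_equiv b a -> a \in Gen C m -> b \in Gen C m.
Proof.
move=> /forallP/(_ ord_max) /= ba; rewrite !inE => /eqP Ga.
by rewrite Ga subloop_orbitT in ba.
Qed.

Lemma matches_orders (A : nat -> {set C}) (s : seq nat) (b : m.-tuple C) :
  size s = m ->
  matches (nth 0 s) A m b =
    (map (@loop_order C) b == s) &&
      [forall i : 'I_m.+1, nested b i \in subloop_orbit (A i)].
Proof.
move=> sz_s; congr (_ && _); apply/forallP/eqP=> [b_s | <- i]; last first.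
  by rewrite (nth_map lone) ?size_tuple.
apply: (@eq_from_nth _ 0); rewrite size_map size_tuple // => i lt_im.
by rewrite (nth_map lone) ?size_tuple //; apply/eqP/(b_s (Ordinal lt_im)).
Qed.

(** Double counting of pairs of a tuple [b] and its sequence of orders [s]: [card_matches] counts
    for fixed [s], and each [b] meets a single [s]. *)
Lemma card_orbit_class r (a : m.-tuple C) : a \in Gen C m ->
  #|[set b in Gen_type C r | orbit_equiv b a]| =
    \sum_(s <- permutations r)
       \prod_(i < m) Gamma (nth 0 s i) (nested a i) (nested a i.+1).
Proof.
move=> Ga; transitivity (\sum_(s <- permutations r)
    #|[set b : m.-tuple C | matches (nth 0 s) (nested a) m b]|); last first.
  by apply: eq_bigr => s _; rewrite card_matches.
under eq_big_seq => s do [rewrite mem_permutations => /perm_size;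
  rewrite size_tuple => sz_s; rewrite -sum1dep_card;
  under eq_bigl => b do rewrite matches_orders //; rewrite big_mkcond /=].
rewrite exchange_big -sum1dep_card big_mkcond /=; apply: eq_bigr => b _.
rewrite /Gen_type inE of_typeE -mem_permutations.
rewrite -/(orbit_equiv b a).
have [ba | _] := boolP (orbit_equiv b a); last first.
  by rewrite andbF; under eq_bigr do rewrite andbF; rewrite big1.
rewrite (orbit_equiv_Gen ba Ga) andbT /=; under eq_bigr do rewrite andbT.
rewrite -big_mkcond sum1_count /=.
(* As [permutations r] has no repetition, the sequence of orders of [b] occurs in it once if [b] has
   type [r], and never otherwise. *)
under eq_count => s do rewrite eq_sym.
by rewrite count_uniq_mem ?permutations_uniq //; case: (_ \in _).
Qed.

End Counting.

Local Open Scope ring_scope.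

Theorem mainTheorem2 (C : finLoopType) (m : nat) (r : m.-tuple nat)
    (repr : {set m.-tuple C} -> m.-tuple C) :
  power_associative C ->
  (1 <= m)%N ->
  (forall i : 'I_m, (0 < tnth r i)%N) ->
  (forall K, K \in Gen_classes C r -> repr K \in K) ->
  gen_prob C r =
    #|C|%:R ^- m *
    (\sum_(K in Gen_classes C r) \sum_(s <- permutations r)
       \prod_(i < m)
          Gamma (nth 0 s i) (nested (repr K) i) (nested (repr K) i.+1))%N%:R.
Proof.
move=> _ _ _ repr_in; rewrite /gen_prob; congr (_ * _%:R).
have eqR : {in Gen_type C r & &, equivalence_rel (@orbit_equiv C m)}.
  by move=> a b c _ _ _; apply: orbit_equiv_rel.
rewrite (card_partition (equivalence_partitionP eqR)).
apply: eq_bigr => K KG; have := repr_in K KG.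
(* The class comes as the tuples equivalent to some [a], not to the chosen [b]; since [a] and [b]
   are equivalent, both describe the same set. *)
case/imsetP: KG => a _ ->; set b := repr _; rewrite inE => /andP[].
rewrite inE => /andP[Gb _] ab; rewrite -card_orbit_class //.
apply: eq_card => c; rewrite !inE; congr (_ && _).
by rewrite (orbit_equiv_rel a b c).2 // orbit_equiv_sym.
Qed.
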